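(* Let $n,m\ge 1$ be integers, let $\zeta_n=e^{2\pi\sqrt{-1}/n}$, and for positive integers $s_1,\dots,s_m$ put $$\mathfrak Z_n(\zeta_n;;s_1,\dots,s_m)=\sum_{1\le i_1<i_2<\dots<i_m\le n-1}\frac{1}{(1-\zeta_n^{i_1})^{s_1}(1-\zeta_n^{i_2})^{s_2}\cdots(1-\zeta_n^{i_m})^{s_m}}.$$ For a positive integer $A$ and $1\le j\le m$ write $\mathfrak Z_n(\zeta_n;;1^{j-1},A,1^{m-j})$ for $\mathfrak Z_n(\zeta_n;;s_1,\dots,s_m)$ with $s_j=A$ and $s_i=1$ for $i\neq j$. Then \begin{align*} \sum_{j=1}^{m}\mathfrak Z_n(\zeta_n;;1^{j-1},2,1^{m-j})&=-\frac{m(n-2 m-3)}{2(m+1)(m+2)}\binom{n-1}{m},\\ \sum_{j=1}^{m}\mathfrak Z_n(\zeta_n;;1^{j-1},3,1^{m-j})&=\frac{1}{m+1}\binom{n-1}{m}\left(-\frac{(n-1)(n-5)}{12}+\frac{(m+1)(n-2 m-5)(n-m-1)}{2(m+2)(m+3)}\right),\\ \sum_{j=1}^{m}\mathfrak Z_n(\zeta_n;;1^{j-1},4,1^{m-j})&=-\frac{(n-1)(n-3)}{8(m+1)}\binom{n-1}{m}+\frac{(n-1)(n-5)}{12(m+2)}\binom{n-1}{m+1}-\frac{(m+2)(n-2 m-7)}{2(m+3)(m+4)}\binom{n-1}{m+2},\\ \sum_{j=1}^{m}\mathfrak Z_n(\zeta_n;;1^{j-1},5,1^{m-j})&=\frac{(n-1)(n^3+n^2-109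 n+251)}{6!\,(m+1)}\binom{n-1}{m}+\frac{(n-1)(n-3)}{8(m+2)}\binom{n-1}{m+1}\\ &\quad -\frac{(n-1)(n-5)}{12(m+3)}\binom{n-1}{m+2}+\frac{(m+3)(n-2 m-9)}{2(m+4)(m+5)}\binom{n-1}{m+3}. \end{align*}
   Context: Binomial coefficients $\binom{a}{b}$ are zero when $b>a$ or $b<0$; an empty sum is $0$. *)

(* Defs.v *)
From mathcomp Require Import all_boot all_order all_algebra.
From mathcomp Require Import reals.
From mathcomp Require Import sequences exp trigo.
From mathcomp Require Import complex.

Set Implicit Arguments.
Unset Strict Implicit.
Unset Printing Implicit Defensive.

Import GRing.Theory Num.Theory.
Local Open Scope ring_scope.

Section Definitions.
Variable R : realType.

(* The complex exponential, by Euler's formula: the library only has the real one. *)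
Definition cexp (z : R[i]) : R[i] :=
  (expR (complex.Re z))%:C%C
  * (cos (complex.Im z) +i* sin (complex.Im z))%C.

Definition zeta (n : nat) : R[i] :=
  cexp (2 * (pi : R)%:C%C * 'i%C / n%:R).

(* [i] encodes the index tuple 1 <= i_1 < ... < i_m <= n - 1; the upper bound
   comes from the type 'I_n.  The positions of the tuple, and hence the
   exponents [s], are numbered from 0. *)
Definition is_index (n m : nat) (i : {ffun 'I_m -> 'I_n}) : bool :=
  [forall a, (0 < i a)%N] &&
  [forall a : 'I_m, forall b : 'I_m, (a < b)%N ==> (i a < i b)%N].

Definition frakZ (n m : nat) (z : R[i]) (s : 'I_m -> nat) : R[i] :=
  \sum_(i : {ffun 'I_m -> 'I_n} | is_index i)
    1 / (\prod_(k < m) (1 - z ^+ i k) ^+ s k).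

End Definitions.

(* The exponents (1^{j-1}, A, 1^{m-j}). *)
Definition one_except (m : nat) (j : 'I_m) (A : nat) (k : 'I_m) : nat :=
  if k == j then A else 1%N.

(* Main.v *)
Require Import Defs.
From mathcomp Require Import all_boot all_order all_algebra.
From mathcomp Require Import reals complex.
From mathcomp Require Import trigo exp ring.

Import Order.TTheory GRing.Theory Num.Theory.

Local Open Scope ring_scope.

(* Put x_i = 1 / (1 - z^i).  The sum over j is the monomial symmetric function
   of shape (A, 1^{m-1}) in the x_i, which satisfies the recursion
   h_{a+1,k} = p_a e_k - h_{a,k+1} with h_{1,k} = k e_k, where e_k and p_a are
   the elementary symmetric functions and the power sums; also p_a = h_{a,1}.
   The e_k are read off from
   (X + 1)^n - 1 = \prod_i (X + 1 - z^i) = n X \prod_{i > 0} (1 + x_i X),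
   which gives n e_k = 'C(n, k+1). *)

(** * Elementary, power-sum and hook-shaped symmetric functions *)

Section SymmetricFunctions.
Variables (F : comNzRingType) (T : finType) (x : T -> F).

Definition elem_sym (k : nat) : F := \sum_(B : {set T} | #|B| == k) \prod_(i in B) x i.

Definition psum (a : nat) : F := \sum_i x i ^+ a.

(* The monomial symmetric function of shape (a, 1^{k-1}), for [1 < a]. *)
Definition hook (a k : nat) : F :=
  \sum_(B : {set T} | #|B| == k) \sum_(j in B) x j ^+ a * \prod_(i in B :\ j) x i.

Lemma elem_sym0 : elem_sym 0 = 1.
Proof.
rewrite /elem_sym (bigD1 set0) ?cards0 //= big_set0 big1 ?addr0 // => B.
by rewrite cards_eq0 => /andP[->].
Qed.

Lemma hook0 a : hook a 0 = 0.
Proof. by rewrite /hook big1 // => B /eqP/cards0_eq ->; rewrite big_set0. Qed.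

Lemma hook1 k : hook 1 k = k%:R * elem_sym k.
Proof.
rewrite /hook /elem_sym mulr_sumr; apply: eq_bigr => B /eqP <-.
transitivity (\sum_(j in B) \prod_(i in B) x i); last by rewrite sumr_const mulr_natl.
by apply: eq_bigr => j jB; rewrite [RHS](big_setD1 j jB).
Qed.

(** In a product of [x j ^+ a] with the monomial of a [k]-set [B], either [j] is in [B] and its
    exponent rises to [a.+1], or [j] extends [B] to a set of size [k.+1] in which it is marked with
    exponent [a]. *)
Lemma psum_elem_sym a k : psum a * elem_sym k = hook a k.+1 + hook a.+1 k.
Proof.
rewrite /psum /elem_sym /hook mulr_suml.
rewrite [X in _ = X + _](exchange_big_dep predT) //=.
rewrite [X in _ = _ + X](exchange_big_dep predT) //= -big_split /=.
apply: eq_bigr => j _; rewrite mulr_sumr (bigID (fun B : {set T} => j \in B)) /= addrC.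
congr (_ + _); last first.
  apply: eq_bigr => B /andP[_ jB].
  by rewrite (big_setD1 j jB) /= mulrA -exprSr.
(* Sets of size [k.+1] containing [j] correspond to [k]-sets avoiding [j]. *)
rewrite [RHS](reindex_onto (fun B : {set T} => j |: B) (fun B => B :\ j)) /=; last first.
  by move=> B /andP[_ jB]; rewrite setD1K.
apply: eq_big => [B|B /andP[_ jB]]; last by rewrite setU1K.
rewrite cardsU1 setU11 andbT; case: (boolP (j \in B)) => jB /=.
  rewrite andbF; apply/esym/negbTE; rewrite negb_and orbC.
  by apply/orP; left; apply: contraL jB => /eqP <-; rewrite !inE eqxx.
by rewrite setU1K // eqxx !andbT.
Qed.

Lemma hookS a k : hook a.+1 k = psum a * elem_sym k - hook a k.+1.
Proof. by rewrite psum_elem_sym addrAC subrr add0r. Qed.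

(** The case [k = 0] of the recursion. It lets each evaluated hook supply a power sum for the later
    ones. *)
Lemma psum_hook a : psum a = hook a 1.
Proof. by rewrite -[LHS]mulr1 -elem_sym0 psum_elem_sym hook0 addr0. Qed.

Lemma coef_prod_elem_sym k : (\prod_i (1 + (x i)%:P * 'X))`_k = elem_sym k.
Proof.
under eq_bigr do rewrite addrC.
rewrite bigA_distr coef_sum /elem_sym [RHS]big_mkcond /=; apply: eq_bigr => B _.
rewrite -big_mkcond /= big_split /= prodr_const -rmorph_prod /=.
by rewrite coefCM coefXn eq_sym; case: eqP; rewrite ?mulr1 ?mulr0.
Qed.

End SymmetricFunctions.

Arguments elem_sym {F T} x k.
Arguments psum {F T} x a.
Arguments hook {F T} x a k.

(** * Increasing tuples as subsets *)

Definition increasing (n m : nat) (i : {ffun 'I_m -> 'I_n}) : bool :=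
  [forall a : 'I_m, forall b : 'I_m, (a < b)%N ==> (i a < i b)%N].

Lemma increasingP (n m : nat) (i : {ffun 'I_m -> 'I_n}) :
  reflect (forall a b : 'I_m, (a < b)%N -> (i a < i b)%N) (increasing n m i).
Proof. by apply: (iffP 'forall_forallP) => inc a b; apply/implyP/inc. Qed.

Lemma increasing_inj n m (i : {ffun 'I_m -> 'I_n}) : increasing n m i -> injective i.
Proof.
move=> /increasingP inc a b iab; apply: val_inj.
by case: (ltngtP (val a) (val b)) => // /inc; rewrite iab ltnn.
Qed.

Lemma sorted_enum_set n (B : {set 'I_n}) : sorted (relpre val ltn) (enum B).
Proof.
rewrite {1}/enum_mem -enumT sorted_filter //; first by move=> ? ? ?; apply: ltn_trans.
by rewrite -sorted_map val_enum_ord iota_ltn_sorted.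
Qed.

(** Taking images is a bijection from increasing [m]-tuples to [m]-subsets, inverted by listing a
    subset in increasing order. *)
Lemma sum_increasing (V : nmodType) (n m : nat) (G : {set 'I_n} -> V) :
  \sum_(i : {ffun 'I_m -> 'I_n} | increasing n m i) G [set i k | k : 'I_m] =
  \sum_(B : {set 'I_n} | #|B| == m) G B.
Proof.
pose img (i : {ffun 'I_m -> 'I_n}) := [set i k | k : 'I_m].
have img_inj : {in [set i | increasing n m i] &, injective img}.
  (* Both lists are strictly sorted with the same members, so the image determines the tuple. *)
  have codomE i : increasing n m i -> codom i = enum (img i).
    move=> inc; apply: (@irr_sorted_eq _ (relpre val ltn)).
    - by move=> ? ? ?; apply: ltn_trans.
    - by move=> ?; apply: ltnn.
    - apply: (@homo_sorted _ _ _ (relpre val ltn)); last first.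
        by rewrite -sorted_map val_enum_ord iota_ltn_sorted.
      exact/increasingP.
    - exact: sorted_enum_set.
    - move=> y; rewrite mem_enum; apply/codomP/imsetP => [[k ->]|[k _ ->]].
        by exists k.
      by exists k.
  move=> i i'; rewrite !inE => /codomE ci /codomE ci' eqi; apply/ffunP => k.
  have /eq_in_map : codom i = codom i' by rewrite ci ci' eqi.
  by apply; rewrite mem_enum.
transitivity (\sum_(i in [set i | increasing n m i]) G (img i)).
  by apply: eq_bigl => i; rewrite inE.
rewrite -(big_imset _ img_inj) /=.
apply: eq_bigl => B; apply/imsetP/eqP => [eB | cardB].
  case: eB => i; rewrite inE => inc ->.
  by rewrite card_imset ?card_ord //; apply: increasing_inj.
exists [ffun k => enum_val (cast_ord (esym cardB) k)].
  rewrite inE; apply/increasingP => a b ab; rewrite !ffunE.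
  (* [y0] is a default element for [nth]. *)
  have y0 := enum_val (cast_ord (esym cardB) a); rewrite 2!(enum_val_nth y0).
  apply: (sorted_ltn_nth _ _ (sorted_enum_set _ B)) => //=.
  - by move=> ? ? ?; apply: ltn_trans.
  - by rewrite inE -cardE cardB.
  - by rewrite inE -cardE cardB.
apply/setP => y; apply/idP/imsetP => [yB |[k _ ->]]; last by rewrite ffunE enum_valP.
exists (cast_ord cardB (enum_rank_in yB y)) => //.
by rewrite ffunE cast_ordK enum_rankK_in.
Qed.

(** * Elementary symmetric functions at the roots of unity *)

Section RootsOfUnity.
Variables (F : fieldType) (n : nat) (z : F).
Hypothesis prim_z : n.-primitive_root z.

(* The index 0 contributes 0, as [0^-1 = 0]. *)
Let x (i : 'I_n) : F := (1 - z ^+ i)^-1.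

Lemma elem_sym_unity_root k : n%:R * elem_sym x k = 'C(n, k.+1)%:R.
Proof.
pose i0 : 'I_n := Ordinal (prim_order_gt0 prim_z).
pose c := \prod_(i | i != i0) (1 - z ^+ i).
have prodE : ('X + 1) ^+ n - 1 = c *: ('X * \prod_i (1 + (x i)%:P * 'X)).
  have := congr1 (fun p => p \Po ('X + 1)) (factor_Xn_sub_1 prim_z).
  rewrite rmorphB /= comp_Xn_poly rmorph1 => <-.
  rewrite rmorph_prod /= big_mkord (bigD1 i0) //= [in RHS](bigD1 i0) //=.
  (* At index 0 the right-hand factor is 1, while the left-hand one is [X + 1 - 1], the isolated
     [X]. *)
  rewrite {1}/x expr0 subrr invr0 mul0r addr0 mul1r.
  rewrite rmorphB /= comp_polyX comp_polyC addrK scalerAr; congr (_ * _).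
  rewrite -mul_polyC rmorph_prod -big_split /=; apply: eq_bigr => i ni0.
  (* Primitivity makes [1 - z ^+ i] invertible, so it can be pulled out of [X + 1 - z ^+ i], leaving
     [1 + x i * X]. *)
  have nz : 1 - z ^+ i != 0.
    rewrite subr_eq0 eq_sym -(prim_order_dvd prim_z) gtnNdvd // lt0n.
    by apply: contra ni0 => /eqP i_eq0; apply/eqP/val_inj.
  rewrite rmorphB /= comp_polyX comp_polyC mulrDr mulr1 mulrA -polyCM divff // mul1r.
  by rewrite polyCB ['X + 1]addrC addrAC.
have coefE j : 'C(n, j.+1)%:R = c * elem_sym x j.
  rewrite -coef_prod_elem_sym; have := congr1 (fun p : {poly F} => p`_j.+1) prodE.
  rewrite /= coefZ coefXM /= => <-.
  have -> : ('X + 1 : {poly F}) ^+ n = \poly_(i < n.+1) 'C(n, i)%:R.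
    by rewrite exprD1n poly_def; apply: eq_bigr => i _; rewrite scaler_nat.
  rewrite coefB coef1 subr0 coef_poly.
  by case: ltnP => // nj; rewrite bin_small.
(* The coefficient of [X] itself identifies the constant [c]. *)
have cE : c = n%:R by rewrite -[n in RHS]bin1 coefE elem_sym0 mulr1.
by rewrite coefE cE.
Qed.

End RootsOfUnity.

(** * Closed forms of the hooks from the recursion *)

Section Evaluation.
Variables (F : numFieldType) (n : nat) (z : F).
Hypothesis prim_z : n.-primitive_root z.

Let x (i : 'I_n) : F := (1 - z ^+ i)^-1.
Let N : F := n%:R.
Let B (k : nat) : F := 'C(n.-1, k)%:R.
Let e := elem_sym x.
Let p := psum x.
Let S := hook x.

Let addn_neq0 k j : k%:R + j.+1%:R != 0 :> F.
Proof. by rewrite -natrD pnatr_eq0 addnS. Qed.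

Let add1_neq0 k : k%:R + 1 != 0 :> F.
Proof. exact: (addn_neq0 k 0). Qed.

Let BS k : B k.+1 = (N - 1 - k%:R) / (k%:R + 1) * B k.
Proof.
have n_gt0 := prim_order_gt0 prim_z.
apply: (mulfI (add1_neq0 k)); rewrite mulrA mulrCA divff // mulr1 natr1.
rewrite -natrM mul_bin_left natrM.
(* Truncated and ring subtraction differ only for [k] above [n.-1], where [B k] vanishes. *)
have [le_kn|lt_nk] := leqP k n.-1; last by rewrite /B bin_small // !mulr0.
by rewrite /B natrB // -subn1 natrB.
Qed.

Let B1 : B 1 = N - 1.
Proof. by rewrite BS /B bin0 subr0 add0r divr1 mulr1. Qed.

(** Combines [n e_k = 'C(n, k+1)] with [(k+1) 'C(n, k+1) = n 'C(n-1, k)]. *)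
Let eE k : e k = B k / (k%:R + 1).
Proof.
have n_neq0 : N != 0 by rewrite pnatr_eq0 -lt0n (prim_order_gt0 prim_z).
apply: (mulfI n_neq0); rewrite elem_sym_unity_root // mulrA.
by rewrite -natrM mul_bin_diag natrM natr1 mulrC mulKf // pnatr_eq0.
Qed.

Lemma hook2_unity_root k :
  S 2 k = - (k%:R * (N - 2 * k%:R - 3) / (2 * (k%:R + 1) * (k%:R + 2))) * B k.
Proof.
rewrite /S hookS psum_hook !hook1 -/e !eE B1 BS -[k.+1%:R]natr1.
by field; rewrite addn_neq0 add1_neq0.
Qed.

Let p2 : p 2 = - ((N - 1) * (N - 5) / 12).
Proof. by rewrite /p psum_hook -/S hook2_unity_root B1; field. Qed.

Lemma hook3_unity_root k :
  S 3 k = 1 / (k%:R + 1) * B k *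
          (- ((N - 1) * (N - 5) / 12)
           + (k%:R + 1) * (N - 2 * k%:R - 5) * (N - k%:R - 1)
             / (2 * (k%:R + 2) * (k%:R + 3))).
Proof.
rewrite /S hookS -/S hook2_unity_root -/p p2 -/e eE BS -[k.+1%:R]natr1.
by field; rewrite ?addn_neq0 ?add1_neq0.
Qed.

Let p3 : p 3 = - ((N - 1) * (N - 3) / 8).
Proof. by rewrite /p psum_hook -/S hook3_unity_root B1; field. Qed.

Lemma hook4_unity_root k :
  S 4 k = - ((N - 1) * (N - 3) / (8 * (k%:R + 1))) * B k
          + (N - 1) * (N - 5) / (12 * (k%:R + 2)) * B k.+1
          - (k%:R + 2) * (N - 2 * k%:R - 7) / (2 * (k%:R + 3) * (k%:R + 4)) * B k.+2.
Proof.
(* Unfolding twice gives [p_3 e_k - p_2 e_{k+1} + h_{2,k+2}], which matches the three terms of the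
   claim one by one. *)
rewrite /S hookS (hookS _ _ _ 2) -/S hook2_unity_root -/p p2 p3 -/e !eE.
rewrite -[k.+2%:R]natr1 -[k.+1%:R]natr1.
by field; rewrite ?addn_neq0 ?add1_neq0.
Qed.

Let p4 : p 4 = (N - 1) * (N ^+ 3 + N ^+ 2 - 109 * N + 251) / 6`!%:R.
Proof.
rewrite /p psum_hook -/S hook4_unity_root !BS /B bin0 (_ : 6`! = 720)%N //.
by field.
Qed.

Lemma hook5_unity_root k :
  S 5 k = (N - 1) * (N ^+ 3 + N ^+ 2 - 109 * N + 251) / ((6`!)%:R * (k%:R + 1)) * B k
          + (N - 1) * (N - 3) / (8 * (k%:R + 2)) * B k.+1
          - (N - 1) * (N - 5) / (12 * (k%:R + 3)) * B k.+2
          + (k%:R + 3) * (N - 2 * k%:R - 9) / (2 * (k%:R + 4) * (k%:R + 5)) * B k.+3.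
Proof.
rewrite /S hookS -/S hook4_unity_root -/p p4 -/e eE (_ : 6`! = 720)%N //.
rewrite -[k.+1%:R]natr1.
by field; rewrite ?addn_neq0 ?add1_neq0.
Qed.

End Evaluation.

(** * Primitivity of [zeta] and passage from nested sums to hooks *)

Section Zeta.
Variable R : realType.

Lemma cexp_imaginary (t : R) : cexp (t%:C * 'i)%C = (cos t +i* sin t)%C.
Proof.
have -> : (t%:C * 'i)%C = (0 +i* t)%C :> R[i] by simpc.
by rewrite /cexp /= expR0 mul1r.
Qed.

Lemma cexp_imaginaryX (t : R) k :
  cexp (t%:C * 'i)%C ^+ k = cexp ((k%:R * t)%:C * 'i)%C.
Proof.
elim: k => [|k IH]; first by rewrite expr0 mul0r cexp_imaginary cos0 sin0.
rewrite exprSr IH !cexp_imaginary -natr1 mulrDl mul1r cosD sinD.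
by simpc; congr Complex; rewrite addrC.
Qed.

Lemma zeta_cexp n : zeta R n = cexp ((2 * pi / n%:R)%:C * 'i)%C.
Proof.
by rewrite /zeta !rmorphM /= fmorphV !rmorph_nat; congr cexp; rewrite mulrAC.
Qed.

(** The [k]-th power has real part [cos (2 * u) = 1 - 2 * sin u ^+ 2] with [u = k * pi / n]. For
    [0 < k < n] the angle [u] lies strictly between 0 and [pi], so this is not 1. *)
Lemma zeta_primitive n : (0 < n)%N -> n.-primitive_root (zeta R n).
Proof.
move=> n_gt0; have nR : (0 : R) < n%:R by rewrite ltr0n.
apply/andP; split=> //; apply/forallP => k; rewrite unity_rootE.
have -> : zeta R n ^+ k.+1 = cexp (((k.+1%:R / n%:R * pi) *+ 2)%:C * 'i)%C.
  rewrite zeta_cexp cexp_imaginaryX.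
  by rewrite (_ : k.+1%:R * (2 * pi / n%:R) = (k.+1%:R / n%:R * pi) *+ 2) //; ring.
rewrite cexp_imaginary; have := ltn_ord k; rewrite leq_eqVlt.
case: eqVneq => [-> _|kn /= lt_kn].
  by rewrite divff ?lt0r_neq0 // mul1r cos2pi sin2pi !eqxx.
apply/eqP/negbTE; rewrite eq_complex negb_and /= cos_mulr2n.
set u := _ * pi; have sin_gt0 : 0 < sin u.
  apply: sin_gt0_pi; rewrite mulr_gt0 ?divr_gt0 ?ltr0n ?pi_gt0 //=.
  by rewrite gtr_pMl ?pi_gt0 // ltr_pdivrMr // mul1r ltr_nat.
apply/orP; left; rewrite cos2sin2.
rewrite -subr_eq0 (_ : _ - 1 = - (sin u ^+ 2 *+ 2)); last by ring.
by rewrite oppr_eq0 mulrn_eq0 /= expf_neq0 // gt_eqF.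
Qed.

(* Tuples containing 0 may be added: their terms vanish, as [(1 - z ^+ 0)^-1 = 0]. *)
Lemma frakZ_increasing n m (z : R[i]) (s : 'I_m -> nat) :
  (forall k, 0 < s k)%N ->
  frakZ n z s = \sum_(i : {ffun 'I_m -> 'I_n} | increasing n m i)
                  \prod_(k < m) (1 - z ^+ i k)^-1 ^+ s k.
Proof.
move=> s_gt0; rewrite /frakZ /is_index.
rewrite [RHS](bigID (fun i : {ffun 'I_m -> 'I_n} => [forall k, 0 < i k]%N)) /=.
rewrite [X in _ = _ + X]big1 ?addr0 => [|i /andP[_]].
  apply: eq_big => [i|i _]; first by rewrite andbC.
  by rewrite div1r -prodfV; apply: eq_bigr => k _; rewrite exprVn.
rewrite negb_forall => /existsP[k]; rewrite -eqn0Ngt => /eqP ik0.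
by rewrite (bigD1 k) //= ik0 expr0 subrr invr0 expr0n gtn_eqF // mul0r.
Qed.

(** For an increasing tuple with image [B], the position [j] of the exponent [A] amounts to the
    marked element [i j] of [B]. *)
Lemma sum_frakZ n m (z : R[i]) A : (0 < A)%N ->
  \sum_(j < m) frakZ n z (one_except j A) =
  hook (fun i : 'I_n => (1 - z ^+ i)^-1) A m.
Proof.
move=> A_gt0; rewrite /hook -sum_increasing.
under eq_bigr => j _.
  rewrite frakZ_increasing; last by move=> k; rewrite /one_except; case: eqP.
  over.
rewrite exchange_big /=; apply: eq_bigr => i /increasing_inj inj_i.
rewrite big_imset /=; last by move=> ? ? _ _; apply: inj_i.
apply: eq_bigr => j _; rewrite (bigD1 j) //= {1}/one_except eqxx; congr (_ * _).
(* By injectivity, removing the value [i j] removes exactly the position [j]. *)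
have -> : [set i k | k : 'I_m] :\ i j = [set i k | k in [set~ j]].
  apply/setP => y; apply/setD1P/imsetP => [[yj /imsetP[k _ yk]] | [k kj ->]].
    by exists k => //; rewrite !inE; apply: contraNneq yj => <-; rewrite yk.
  by rewrite (inj_eq inj_i) imset_f //; move: kj; rewrite !inE.
rewrite big_imset /=; last by move=> ? ? _ _; apply: inj_i.
apply: eq_big => [k|k kj]; first by rewrite !inE.
by rewrite /one_except (negbTE kj).
Qed.

End Zeta.

Theorem theorem1 (R : realType) (n m : nat) (hn : (1 <= n)%N) (hm : (1 <= m)%N) :
  let N : R[i] := n%:R in
  let M : R[i] := m%:R in
  let B (k : nat) : R[i] := ('C(n.-1, k))%:R in
  let S (A : nat) : R[i] :=
    \sum_(j < m) frakZ n (zeta R n) (one_except j A) in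
  [/\ S 2%N = - (M * (N - 2 * M - 3) / (2 * (M + 1) * (M + 2))) * B m,
      S 3%N = 1 / (M + 1) * B m *
              (- ((N - 1) * (N - 5) / 12)
               + (M + 1) * (N - 2 * M - 5) * (N - M - 1)
                 / (2 * (M + 2) * (M + 3))),
      S 4%N = - ((N - 1) * (N - 3) / (8 * (M + 1))) * B m
              + (N - 1) * (N - 5) / (12 * (M + 2)) * B m.+1
              - (M + 2) * (N - 2 * M - 7) / (2 * (M + 3) * (M + 4)) * B m.+2
    & S 5%N = (N - 1) * (N ^+ 3 + N ^+ 2 - 109 * N + 251)
                / ((6`!)%:R * (M + 1)) * B m
              + (N - 1) * (N - 3) / (8 * (M + 2)) * B m.+1
              - (N - 1) * (N - 5) / (12 * (M + 3)) * B m.+2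
              + (M + 3) * (N - 2 * M - 9) / (2 * (M + 4) * (M + 5)) * B m.+3].
Proof.
move=> N M B S; have prim := zeta_primitive R _ hn.
split; rewrite /S sum_frakZ //.
- exact: (hook2_unity_root _ _ _ prim).
- exact: (hook3_unity_root _ _ _ prim).
- exact: (hook4_unity_root _ _ _ prim).
- exact: (hook5_unity_root _ _ _ prim).
Qed.
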